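(* Let a biobjective robust problem $\mathrm{BRO}(\mathcal{U})$ be given such that (BRO-1) and (BRO-3) hold, and assume that $\mathcal{U}$ is non-empty and finite. Then the dichotomic search algorithm applied to $\mathrm{BRO}(\mathcal{U})$ (i.e. with $g=f^{\mathcal{U}}$) returns a set $Y^\ast$ containing all extreme supported nondominated points and a set $X^\ast$ containing a representative set of extreme supported efficient solutions of $\mathrm{BRO}(\mathcal{U})$, after $2|Y^\ast|-3$ iterations of its while-loop if $|Y^\ast|>2$ and after zero iterations if $|Y^\ast|=1$.
   Context: Orders: for $y,\bar y\in\mathbb{R}^p$, $\le$ and $<$ are componentwise; $y\preceq\bar y$ ($y$ dominates $\bar y$) means $y\le\bar y$ and $y\ne\bar y$. Problem: $\mathrm{BRO}(\mathcal{U})$ is the problem $\min_{x\in\mathcal{X}} f^{\mathcal{U}}(x)$ with $f^{\mathcal{U}}(x)=(f_1^{\mathcal{U}}(x),f_2^{\mathcal{U}}(x))^t$, $f_i^{\mathcal{U}}(x)=\sup_{\xi\in\mathcal{U}}f_i(x,\xi)$, where $f_1,f_2:\mathcal{X}\times\mathcal{U}\to\mathbb{R}$. (BRO-1): $\mathcal{X}=P\cap(\mathbb{Z}^k\times\mathbb{R}^{n-k})$ with $P\subseteq\mathbb{R}^n$ a polytope and $0\le k\le n$; $\mathcal{X}$ is nonempty. (BRO-3): $f_1,f_2$ are linear in $x$ for every fixed $\xi\in\mathcal{U}$, and quasi-convex and continuous in $\xi$ for every fixed $x\in\mathcal{X}$ (for finite $\mathcal{U}$, $f_i(x,\cdot)$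 is understood as a function on $\mathrm{conv}(\mathcal{U})$). Solutions: for $\min_{x\in\mathcal{X}}g(x)$ with $\mathcal{Y}=g(\mathcal{X})$, $x\in\mathcal{X}$ is efficient and $g(x)$ nondominated if no $x'\in\mathcal{X}\setminus\{x\}$ has $g(x')\preceq g(x)$. A point $y\in\mathcal{Y}$ is extreme supported nondominated if there is no convex combination of nondominated points $y^{(1)},\dots,y^{(N)}\in\mathcal{Y}\setminus\{y\}$ with $\sum_i\lambda_iy^{(i)}\le y$; $x$ is extreme supported efficient if $g(x)$ is extreme supported nondominated. A representative set of extreme supported efficient solutions is a subset of $\mathcal{X}$ whose image under $g$ is exactly the set of extreme supported nondominated points. Dichotomic search for $\min_{x\in\mathcal{X}}(g_1(x),g_2(x))^t$: Compute $\epsilon_1=\min_{\mathcal{X}}g_1$, $x^L\in\arg\min_{x\in\mathcal{X}}\{g_2(x):g_1(x)\le\epsilon_1\}$, $y^L=g(x^L)$; $\epsilon_2=\min_{\mathcal{X}}g_2$, $x^R\in\arg\min_{x\in\mathcal{X}}\{g_1(x):g_2(x)\le\epsilon_2\}$, $y^R=g(x^R)$. If $y^L=y^R$, stop and return $Y^\ast=\{y^L\}$, $X^\ast=\{x^L\}$. Otherwise set $Y^\ast=\{y^L,y^R\}$, $X^\ast=\{x^L,x^R\}$, $\mathcal{L}=\{(y^L,y^R)\}$. While $\mathcal{L}\ne\emptyset$: remove an element $(y^l,y^r)$ from $\mathcal{L}$; set $\lambda=(y^l_2-y^r_2,\,y^r_1-y^l_1)$; determine some $x^\ast\in\arg\min_{x\in\mathcal{X}}\lambda^Tg(x)$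 and set $y^\ast=g(x^\ast)$; if $\lambda^Ty^\ast<\lambda^Ty^l$, add $y^\ast$ to $Y^\ast$, $x^\ast$ to $X^\ast$, and $(y^l,y^\ast),(y^\ast,y^r)$ to $\mathcal{L}$. Return $Y^\ast,X^\ast$. The minimization problems occurring in the algorithm are assumed to be solved exactly (by an oracle). *)

(* Defs.v *)
From HB Require Import structures.
From mathcomp Require Import all_boot all_order all_algebra finmap.
From mathcomp Require Import all_classical all_reals all_analysis.

Set Implicit Arguments.
Unset Strict Implicit.
Unset Printing Implicit Defensive.

Import Order.TTheory GRing.Theory Num.Theory.
Import numFieldNormedType.Exports.

Local Open Scope fset_scope.
Local Open Scope classical_set_scope.
Local Open Scope ring_scope.

(* The coordinates y_1, y_2 of y : 'rV[R]_2 are y 0 0 and y 0 1. *)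

Definition vle (R : realType) (p : nat) (y y' : 'rV[R]_p) : Prop :=
  forall i, y 0 i <= y' 0 i.

Definition dominates (R : realType) (p : nat) (y y' : 'rV[R]_p) : Prop :=
  vle y y' /\ y <> y'.

Definition dotv (R : realType) (p : nat) (u v : 'rV[R]_p) : R :=
  \sum_i u 0 i * v 0 i.

(* The set of all (finite) convex combinations of points of A. *)
Definition conv_hull (R : realType) (p : nat) (A : set 'rV[R]_p) :
    set 'rV[R]_p :=
  [set v | exists (N : nat) (lam : 'I_N -> R) (ys : 'I_N -> 'rV[R]_p),
     [/\ forall i, 0 <= lam i, \sum_i lam i = 1, forall i, A (ys i)
       & v = \sum_i lam i *: ys i]].

Definition polytope (R : realType) (n : nat) (P : set 'rV[R]_n) : Prop :=
  exists2 V : set 'rV[R]_n, finite_set V & P = conv_hull V.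

(* Z^k x R^(n-k), for k <= n. *)
Definition mixed_int (R : realType) (n k : nat) : set 'rV[R]_n :=
  [set x | forall i : 'I_n, (i < k)%N -> x 0 i \is a Num.int].

Definition linear_on (R : realType) (n : nat) (D : set 'rV[R]_n)
    (h : 'rV[R]_n -> R) : Prop :=
  exists l : {linear 'rV[R]_n -> R^o}, forall x, D x -> h x = l x.

Definition quasiconvex_on (R : realType) (m : nat) (D : set 'rV[R]_m)
    (h : 'rV[R]_m -> R) : Prop :=
  forall a b t, D a -> D b -> 0 <= t <= 1 ->
    h (t *: a + (1 - t) *: b) <= Num.max (h a) (h b).

Definition robust (R : realType) (n m : nat)
    (f : 'I_2 -> 'rV[R]_n -> 'rV[R]_m -> R) (U : set 'rV[R]_m)
    (x : 'rV[R]_n) : 'rV[R]_2 :=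
  \row_i sup [set f i x xi | xi in U].

Section Solutions.
Variables (R : realType) (n : nat).
Variables (X : set 'rV[R]_n) (g : 'rV[R]_n -> 'rV[R]_2).

Definition efficient (x : 'rV[R]_n) : Prop :=
  X x /\ ~ exists x', [/\ X x', x' <> x & dominates (g x') (g x)].

Definition nondominated : set 'rV[R]_2 := g @` efficient.

Definition ext_supp_nondominated : set 'rV[R]_2 :=
  [set y | (g @` X) y /\
     ~ exists2 z, conv_hull (nondominated `\ y) z & vle z y].

Definition representative (S : set 'rV[R]_n) : Prop :=
  S `<=` X /\ g @` S = ext_supp_nondominated.

End Solutions.

Definition argmin (T : Type) (R : realType) (D : set T) (h : T -> R) : set T :=
  [set x | D x /\ forall x', D x' -> h x <= h x'].

Definition is_min (T : Type) (R : realType) (D : set T) (h : T -> R)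
    (e : R) : Prop :=
  exists2 x, argmin D h x & h x = e.

(* Dichotomic search is nondeterministic: the removed pair and the minimizers
   (supplied by an oracle) are arbitrary.  It is therefore modelled as a
   transition system, one transition per iteration of the while-loop. *)
Record ds_state (R : realType) (n : nat) := DsState {
  dsY : {fset 'rV[R]_2};
  dsX : {fset 'rV[R]_n};
  dsL : {fset 'rV[R]_2 * 'rV[R]_2} }.

Definition ds_weight (R : realType) (yl yr : 'rV[R]_2) : 'rV[R]_2 :=
  \row_i (if i == 0 then yl 0 1 - yr 0 1 else yr 0 0 - yl 0 0).

Section DichotomicSearch.
Variables (R : realType) (n : nat).
Variables (X : set 'rV[R]_n) (g : 'rV[R]_n -> 'rV[R]_2).

Definition ds_start (xL xR : 'rV[R]_n) : ds_state R n :=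
  if g xL == g xR then DsState [fset g xL]%fset [fset xL]%fset fset0
  else DsState [fset g xL; g xR]%fset [fset xL; xR]%fset [fset (g xL, g xR)]%fset.

Inductive ds_init : ds_state R n -> Prop :=
| DsInit (e1 e2 : R) (xL xR : 'rV[R]_n) :
    is_min X (fun x => g x 0 0) e1 ->
    argmin [set x | X x /\ g x 0 0 <= e1] (fun x => g x 0 1) xL ->
    is_min X (fun x => g x 0 1) e2 ->
    argmin [set x | X x /\ g x 0 1 <= e2] (fun x => g x 0 0) xR ->
    ds_init (ds_start xL xR).

Definition ds_update (s : ds_state R n) (yl yr : 'rV[R]_2) (xs : 'rV[R]_n) :
    ds_state R n :=
  let lam := ds_weight yl yr in
  let L := (dsL s `\ (yl, yr))%fset in
  if dotv lam (g xs) < dotv lam yl then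
    DsState (g xs |` dsY s)%fset (xs |` dsX s)%fset
            ([fset (yl, g xs); (g xs, yr)] `|` L)%fset
  else DsState (dsY s) (dsX s) L.

Inductive ds_step (s : ds_state R n) : ds_state R n -> Prop :=
| DsStep (yl yr : 'rV[R]_2) (xs : 'rV[R]_n) :
    (yl, yr) \in dsL s ->
    argmin X (fun x => dotv (ds_weight yl yr) (g x)) xs ->
    ds_step s (ds_update s yl yr xs).

(* s is a possible state after N iterations. *)
Inductive ds_reach : nat -> ds_state R n -> Prop :=
| DsReach0 s : ds_init s -> ds_reach 0 s
| DsReachS N s s' : ds_reach N s -> ds_step s s' -> ds_reach N.+1 s'.

Definition ds_returns_after (N : nat) (s : ds_state R n) : Prop :=
  ds_reach N s /\ dsL s = fset0.

(* All choices of the algorithm can be made (the minima exist) and, however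
   they are made, the loop is left after finitely many iterations. *)
Definition ds_terminates : Prop :=
  [/\ exists s, ds_init s,
      forall N s, ds_reach N s -> dsL s != fset0 -> exists s', ds_step s s'
    & ~ exists run : nat -> ds_state R n,
          ds_init (run 0%N) /\ forall i, ds_step (run i) (run i.+1)].

End DichotomicSearch.

(* Main.v *)
(* Every point entered in Y* is nondominated and lies on the lower-left boundary
   of the convex hull of the image, and the pairs in L join consecutive points
   of Y*; hence a point found strictly below the chord of (yl, yr) lies strictly
   between yl and yr and is new. A success adds one point and one pair, a
   failure removes one pair, so N + |L| = 2 |Y*| - 3 throughout unless yL = yR.
   When L is empty, the chords of Y* support the image and cover the range
   between its ends, so a point of the image outside Y* is above a convex
   combination of one or two points of Y*.
   For termination, give x a combinatorial type: its integer part, the support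
   of its convex weights on the vertices of P, and its active scenarios. If x
   minimizes lam^T g and x' has the same type, then x + e (x - x') is feasible
   for small e > 0 and g (x + e (x - x')) <= g x + e (g x - g x'), so x'
   minimizes lam^T g as well. Thus each success produces a type not seen before
   in X*, and there are only finitely many types. *)

Require Import Defs.
From HB Require Import structures.
From mathcomp Require Import all_boot all_order all_algebra finmap.
From mathcomp Require Import all_classical all_reals all_analysis.
From mathcomp Require Import ring lra zify.

Import Order.TTheory GRing.Theory Num.Theory.
Import numFieldNormedType.Exports.

Local Open Scope fset_scope.
Local Open Scope classical_set_scope.
Local Open Scope ring_scope.

Set Implicit Arguments.
Unset Strict Implicit.
Unset Printing Implicit Defensive.

(** * Planar geometry: nondominated points and chords of a point set *)

Section Plane.
Variable R : realType.
Implicit Types a b c u v y : 'rV[R]_2.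

Lemma dotv2 u v : dotv u v = u 0 0 * v 0 0 + u 0 1 * v 0 1.
Proof.
rewrite /dotv big_ord_recl big_ord_recl big_ord0 addr0.
by have -> : lift ord0 ord0 = 1 :> 'I_2 by apply/val_inj.
Qed.

Lemma row2P u v : u 0 0 = v 0 0 -> u 0 1 = v 0 1 -> u = v.
Proof.
move=> e0 e1; apply/rowP => i.
have [-> //|->//] : i = 0 \/ i = 1.
by case: i => -[|[|//]] Hi; [left|right]; apply/val_inj.
Qed.

Lemma vle2 u v : vle u v <-> u 0 0 <= v 0 0 /\ u 0 1 <= v 0 1.
Proof.
split=> [uv|[uv0 uv1] i]; first by split; exact: uv.
have [->//|->//] : i = 0 \/ i = 1.
by case: i => -[|[|//]] Hi; [left|right]; apply/val_inj.
Qed.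

Variable Z : set 'rV[R]_2.

Definition nondom y := forall z, Z z -> vle z y -> z = y.

Lemma nondom_inj y z : Z y -> Z z -> nondom y -> nondom z ->
  y 0 0 = z 0 0 -> y = z.
Proof.
move=> Zy Zz ny nz e; have [le|/ltW le] := leP (y 0 1) (z 0 1).
  by apply: nz => //; apply/vle2; rewrite e.
by apply/esym/ny => //; apply/vle2; rewrite e.
Qed.

(* y lies on or below the chord of any two points of Z on either side of it. *)
Definition on_hull y := forall u v, Z u -> Z v ->
  u 0 0 < y 0 0 -> y 0 0 < v 0 0 ->
  dotv (ds_weight u v) y <= dotv (ds_weight u v) u.

Lemma argmin_nondom (lam y : 'rV[R]_2) : 0 < lam 0 0 -> 0 < lam 0 1 ->
  (forall z, Z z -> dotv lam y <= dotv lam z) -> nondom y.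
Proof.
move=> l0 l1 ymin z Zz /vle2[z0 z1].
move: (ymin _ Zz); rewrite !dotv2 => h.
have h0 : lam 0 0 * z 0 0 <= lam 0 0 * y 0 0 by rewrite ler_pM2l.
have h1 : lam 0 1 * z 0 1 <= lam 0 1 * y 0 1 by rewrite ler_pM2l.
apply: row2P.
  by apply: (mulfI (lt0r_neq0 l0)); lra.
by apply: (mulfI (lt0r_neq0 l1)); lra.
Qed.

Lemma argmin_on_hull (lam y : 'rV[R]_2) : 0 < lam 0 1 ->
  (forall z, Z z -> dotv lam y <= dotv lam z) -> on_hull y.
Proof.
move=> l1 ymin u v Zu Zv uy yv.
move: (ymin _ Zu) (ymin _ Zv); rewrite !dotv2 !mxE /= => hu hv.
rewrite -(ler_pM2l l1).
rewrite -subr_gt0 in uy; rewrite -subr_gt0 in yv.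
by have := ler_wpM2l (ltW yv) hu; have := ler_wpM2l (ltW uy) hv; lra.
Qed.

(** If [c], strictly left of [a], were below the line through [a] and [b], then [a] would be above
    the chord of [c] and [b], against [on_hull]; the right side is symmetric. At equal first
    coordinates nondominance decides. *)
Lemma above_hull_chord a b c : Z b -> Z a -> Z c -> nondom a -> nondom b ->
  on_hull a -> on_hull b -> a 0 0 < b 0 0 ->
  c 0 0 <= a 0 0 \/ b 0 0 <= c 0 0 ->
  dotv (ds_weight a b) a <= dotv (ds_weight a b) c.
Proof.
move=> Zb Za Zc na nb ha hb ab.
have nd y : Z y -> nondom y -> y 0 0 = c 0 0 -> y 0 1 <= c 0 1.
  move=> Zy ny e; rewrite leNgt; apply/negP => lt.
  have cy : c = y by apply: ny => //; apply/vle2; rewrite e lexx ltW.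
  by move: lt; rewrite cy ltxx.
have p : 0 < b 0 0 - a 0 0 by rewrite subr_gt0.
rewrite !le_eqVlt => -[/orP[/eqP e|ca]|/orP[/eqP e|bc]].
- have := ler_wpM2l (ltW p) (nd a Za na (esym e)).
  by rewrite !dotv2 !mxE /= e; lra.
- by have := ha _ _ Zc Zb ca ab; rewrite !dotv2 !mxE /=; lra.
- have := ler_wpM2l (ltW p) (nd b Zb nb e).
  by rewrite !dotv2 !mxE /= -e; lra.
- by have := hb _ _ Za Zc ab bc; rewrite !dotv2 !mxE /=; lra.
Qed.

End Plane.

(** * The invariant of the while-loop *)

Section Invariant.
Variables (R : realType) (n : nat).
Variables (X : set 'rV[R]_n) (g : 'rV[R]_n -> 'rV[R]_2).
Implicit Types (s : ds_state R n) (a b c y : 'rV[R]_2) (x : 'rV[R]_n).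

Let Z := g @` X.

Definition explored a b := forall z, Z z ->
  dotv (ds_weight a b) a <= dotv (ds_weight a b) z.

(** The first alternative of [dsL_cover] takes care of the points right of the right end and of the
    case of a single point. The second alternative of [ds_count] is the start with equal ends. *)
Record ds_inv (N : nat) s : Prop := DsInv {
  dsX_sub : forall x, x \in dsX s -> X x /\ g x \in dsY s;
  dsY_sub : forall y, y \in dsY s -> exists2 x, x \in dsX s & g x = y;
  dsY_nondom : forall y, y \in dsY s -> nondom Z y;
  dsY_hull : forall y, y \in dsY s -> on_hull Z y;
  dsL_sub : forall a b, (a, b) \in dsL s -> a \in dsY s /\ b \in dsY s;
  dsL_lt : forall a b, (a, b) \in dsL s -> a 0 0 < b 0 0 /\ b 0 1 < a 0 1;
  dsL_consecutive : forall a b c, (a, b) \in dsL s -> c \in dsY s ->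
    c 0 0 <= a 0 0 \/ b 0 0 <= c 0 0;
  dsL_cover : forall z, Z z -> (exists2 c, c \in dsY s & vle c z) \/
    exists a b, [/\ a \in dsY s, b \in dsY s,
      a 0 0 <= z 0 0 <= b 0 0, a 0 0 < b 0 0
      & (a, b) \in dsL s \/ explored a b];
  ds_count : (N + #|` dsL s| + 3 = 2 * #|` dsY s|)%N \/
    [/\ dsL s = fset0, #|` dsY s| = 1%N & N = 0%N] }.

Lemma dsY_img N s y : ds_inv N s -> y \in dsY s -> Z y.
Proof.
by move=> I /(dsY_sub I)[x /(dsX_sub I)[Xx _] <-]; exists x.
Qed.

Lemma ds_inv_start e1 e2 xL xR :
  is_min X (fun x => g x 0 0) e1 ->
  argmin [set x | X x /\ g x 0 0 <= e1] (fun x => g x 0 1) xL ->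
  is_min X (fun x => g x 0 1) e2 ->
  argmin [set x | X x /\ g x 0 1 <= e2] (fun x => g x 0 0) xR ->
  ds_inv 0 (ds_start g xL xR).
Proof.
move=> [x1 [Xx1 min1] <-] [/= [XL L1] Lmin] [x2 [Xx2 min2] <-] [/= [XR R2] Rmin].
have L1min x : X x -> g xL 0 0 <= g x 0 0.
  by move=> Xx; apply: le_trans L1 (min1 _ Xx).
have R2min x : X x -> g xR 0 1 <= g x 0 1.
  by move=> Xx; apply: le_trans R2 (min2 _ Xx).
have L2min x : X x -> g x 0 0 <= g xL 0 0 -> g xL 0 1 <= g x 0 1.
  by move=> Xx le; apply: Lmin; split=> //; exact: le_trans le L1.
have R1min x : X x -> g x 0 1 <= g xR 0 1 -> g xR 0 0 <= g x 0 0.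
  by move=> Xx le; apply: Rmin; split=> //; exact: le_trans le R2.
have nL : nondom Z (g xL).
  move=> _ [x Xx <-] /vle2[le0 le1]; apply: row2P; apply/le_anti.
    by rewrite le0 L1min.
  by rewrite le1 L2min.
have nR : nondom Z (g xR).
  move=> _ [x Xx <-] /vle2[le0 le1]; apply: row2P; apply/le_anti.
    by rewrite le0 R1min.
  by rewrite le1 R2min.
(* Vacuous at the left end, as no image point lies further left; the right end minimizes the weight
   (0, 1). *)
have hL : on_hull Z (g xL).
  by move=> _ v [x Xx <-] _; rewrite ltNge L1min.
have hR : on_hull Z (g xR).
  apply: (@argmin_on_hull _ _ (\row_i (i == 1)%:R)); first by rewrite mxE.
  by move=> _ [x Xx <-]; rewrite !dotv2 !mxE /= !mul0r !mul1r !add0r R2min.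
rewrite /ds_start; case: eqVneq => [e|neq].
  split=> //=.
  - by move=> x; rewrite !inE => /eqP->.
  - by move=> y; rewrite inE => /eqP->; exists xL; rewrite // inE.
  - by move=> y; rewrite inE => /eqP->.
  - by move=> y; rewrite inE => /eqP->.
  - move=> _ [x Xx <-]; left; exists (g xL); first by rewrite inE.
    by apply/vle2; split; [exact: L1min | rewrite e; exact: R2min].
  - by right; rewrite cardfs1.
have ltLR : g xL 0 0 < g xR 0 0.
  rewrite lt_neqAle L1min // andbT; apply: contra_neq neq => e.
  by apply/esym/nL; [exists xR|apply/vle2; rewrite e R2min].
have ltRL : g xR 0 1 < g xL 0 1.
  rewrite ltNge; apply/negP => le; move: neq; rewrite (nR (g xL)) ?eqxx //.
    by exists xL.
  by apply/vle2; rewrite L1min.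
split=> //=.
- by move=> x; rewrite !inE => /orP[]/eqP->; rewrite eqxx ?orbT.
- move=> y; rewrite !inE => /orP[]/eqP->; [exists xL|exists xR] => //;
  by rewrite !inE eqxx ?orbT.
- by move=> y; rewrite !inE => /orP[]/eqP->.
- by move=> y; rewrite !inE => /orP[]/eqP->.
- by move=> a b; rewrite inE => /eqP[-> ->]; rewrite !inE !eqxx orbT.
- by move=> a b; rewrite inE => /eqP[-> ->].
- move=> a b c; rewrite inE => /eqP[-> ->]; rewrite !inE.
  by case/orP=> /eqP->; [left|right].
- move=> _ [x Xx <-]; have [le|/ltW le] := leP (g xR 0 0) (g x 0 0).
    left; exists (g xR); first by rewrite !inE eqxx orbT.
    by apply/vle2; rewrite R2min.
  right; exists (g xL), (g xR).
  by rewrite !inE !eqxx orbT L1min // le; split=> //; left.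
- by left; rewrite cardfs1 cardfs2 neq.
Qed.

(** Both entries of the weight are positive. A minimizer outside the open strip between [a] and [b]
    would lie on or above their line by [above_hull_chord], and [dsL_consecutive] leaves no known
    point inside the strip. *)
Lemma strict_argmin_new N s a b y : ds_inv N s -> (a, b) \in dsL s -> Z y ->
  (forall z, Z z -> dotv (ds_weight a b) y <= dotv (ds_weight a b) z) ->
  dotv (ds_weight a b) y < dotv (ds_weight a b) a ->
  [/\ nondom Z y, on_hull Z y, a 0 0 < y 0 0 < b 0 0,
    b 0 1 < y 0 1 < a 0 1 & y \notin dsY s].
Proof.
move=> I abL Zy ymin lt.
have [ab ba] := dsL_lt I abL; have [aY bY] := dsL_sub I abL.
have [Za Zb] := (dsY_img I aY, dsY_img I bY).
have [na nb] := (dsY_nondom I aY, dsY_nondom I bY).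
have ny : nondom Z y.
  by apply: argmin_nondom ymin; rewrite mxE /= subr_gt0.
have hy : on_hull Z y by apply: argmin_on_hull ymin; rewrite mxE /= subr_gt0.
have btw : a 0 0 < y 0 0 < b 0 0.
  apply/negPn/negP; rewrite negb_and -!leNgt => /orP btw.
  have := above_hull_chord Zb Za Zy na nb (dsY_hull I aY) (dsY_hull I bY) ab btw.
  by rewrite leNgt lt.
have [ay yb] := andP btw.
split=> //.
  apply/andP; split; rewrite ltNge; apply/negP => le.
    by have e := nb y Zy (proj2 (vle2 _ _) (conj (ltW yb) le)); rewrite e ltxx in yb.
  by have e := ny a Za (proj2 (vle2 _ _) (conj (ltW ay) le)); rewrite e ltxx in ay.
by apply/negP => /(dsL_consecutive I abL); rewrite !leNgt ay yb => -[].
Qed.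

Lemma ds_inv_step N s s' : ds_inv N s -> ds_step X g s s' -> ds_inv N.+1 s'.
Proof.
move=> I [a b x abL [Xx xmin]]; rewrite /ds_update.
have [aY bY] := dsL_sub I abL.
have [ab ba] := dsL_lt I abL.
have cntL : #|` dsL s| = #|` (dsL s `\ (a, b))%fset|.+1 by rewrite (cardfsD1 (a, b)) abL.
have cnt : (N + #|` dsL s| + 3 = 2 * #|` dsY s|)%N.
  by case: (ds_count I) => // -[L0]; rewrite L0 inE in abL.
have gmin z : Z z -> dotv (ds_weight a b) (g x) <= dotv (ds_weight a b) z.
  by case=> x' Xx' <-; exact: xmin.
case: ifPn => [lt|]; last first.
  rewrite -leNgt => le; split=> /=.
  - exact: dsX_sub I.
  - exact: dsY_sub I.
  - exact: dsY_nondom I.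
  - exact: dsY_hull I.
  - by move=> a' b'; rewrite !inE => /andP[_]; exact: dsL_sub I a' b'.
  - by move=> a' b'; rewrite !inE => /andP[_]; exact: dsL_lt I a' b'.
  - by move=> a' b' c; rewrite !inE => /andP[_]; exact: dsL_consecutive I a' b' c.
  - move=> z Zz; have [|[a' [b' [a'Y b'Y z_in ltab' L]]]] := dsL_cover I Zz; first by left.
    right; exists a', b'; split=> //.
    case: L => [L|]; last by right.
    rewrite !inE; have [[-> ->]|/= neq] := eqVneq (a', b') (a, b); last by left.
    (* After a failure the line of the removed pair supports the image, so the pair becomes
       explored. *)
    by right=> z' Zz'; exact: le_trans le (gmin _ Zz').
  - by left; rewrite -cnt cntL addSnnS.
have [ny hy /andP[ay yb] /andP[by' ya] yNY] := strict_argmin_new I abL (imageP g Xx) gmin lt.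
set y := g x in ny hy ay yb by' ya yNY *.
(* [dsL s] is a set, so the count needs both new pairs to be absent from it. *)
have NL1 : (a, y) \notin dsL s by apply/negP => /(dsL_sub I)[_]; exact/negP.
have NL2 : (y, b) \notin dsL s by apply/negP => /(dsL_sub I)[+ _]; exact/negP.
split=> /=.
- move=> x'; rewrite !inE => /predU1P[->|/(dsX_sub I)[Xx' ->]]; last by rewrite orbT.
  by rewrite eqxx.
- move=> y'; rewrite !inE => /predU1P[->|/(dsY_sub I)[x' x'X <-]].
    by exists x; rewrite // !inE eqxx.
  by exists x'; rewrite // !inE x'X orbT.
- by move=> y'; rewrite !inE => /predU1P[->//|]; exact: dsY_nondom I y'.
- by move=> y'; rewrite !inE => /predU1P[->//|]; exact: dsY_hull I y'.
- move=> a' b'; rewrite !inE => /orP[/orP[]/eqP[-> ->]|/andP[_ /(dsL_sub I)[-> ->]]];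
  by rewrite ?eqxx ?aY ?bY !orbT.
- move=> a' b'; rewrite !inE => /orP[/orP[]/eqP[-> ->]//|/andP[_]].
  exact: dsL_lt I a' b'.
- move=> a' b' c; rewrite !inE => /orP[/orP[]/eqP[-> ->]|/andP[neq ab'L]]
      /predU1P[->|cY].
  + by right.
  + case: (dsL_consecutive I abL cY) => ?; [by left|right].
    exact: le_trans (ltW yb) _.
  + by left.
  + case: (dsL_consecutive I abL cY) => ?; [left|by right].
    exact: le_trans _ (ltW ay).
  (* Another pending pair around [y] would enclose the range of [a] and [b]; since both pairs are
     consecutive, their first coordinates agree, and by [nondom_inj] the pairs coincide. *)
  + have [a'Y b'Y] := dsL_sub I ab'L.
    case: (dsL_consecutive I abL b'Y) => [b'a|bb'].
      by right; exact: le_trans b'a (ltW ay).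
    case: (dsL_consecutive I abL a'Y) => [a'a|ba']; last first.
      by left; exact: le_trans (ltW yb) ba'.
    have aa' : a 0 0 <= a' 0 0.
      case: (dsL_consecutive I ab'L aY) => // b'a.
      by have := lt_le_trans ab (le_trans bb' b'a); rewrite ltxx.
    have b'b : b' 0 0 <= b 0 0.
      case: (dsL_consecutive I ab'L bY) => // ba'.
      by have := lt_le_trans ab (le_trans ba' a'a); rewrite ltxx.
    suff e : (a', b') = (a, b) by rewrite e eqxx in neq.
    have eq1 u v : u \in dsY s -> v \in dsY s ->
        u 0 0 <= v 0 0 -> v 0 0 <= u 0 0 -> u = v.
      move=> uY vY uv vu.
      apply: (nondom_inj (dsY_img I uY) (dsY_img I vY) (dsY_nondom I uY)
        (dsY_nondom I vY)).
      by apply/le_anti/andP.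
    by rewrite (eq1 a' a) // (eq1 b' b).
  + exact: dsL_consecutive I _ _ _ ab'L cY.
- move=> z Zz; have [[c cY cz]|[a' [b' [a'Y b'Y z_in ltab' L]]]] := dsL_cover I Zz.
    by left; exists c; rewrite // !inE cY orbT.
  right; case: L => [L|]; last first.
    by move=> ex; exists a', b'; rewrite !inE a'Y b'Y !orbT; split=> //; right.
  have [[ea eb]|/= neq] := eqVneq (a', b') (a, b); last first.
    by exists a', b'; rewrite !inE a'Y b'Y neq L !orbT; split=> //; left.
  case/andP: z_in; rewrite ea eb => az zb.
  have [zy|/ltW yz] := leP (z 0 0) (y 0 0).
    by exists a, y; rewrite !inE !eqxx aY az !orbT; split=> //; left.
  by exists y, b; rewrite !inE !eqxx bY zb yz !orbT; split=> //; left.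
- left; rewrite cardfsU1 yNY.
  have -> : ([fset (a, y); (y, b)] `|` dsL s `\ (a, b))%fset =
     ((a, y) |` ((y, b) |` dsL s `\ (a, b)))%fset by rewrite -fsetUA.
  rewrite !cardfsU1 !inE (negPf NL1) (negPf NL2) !andbF orbF /=.
  have -> : ((a, y) == (y, b)) = false.
    by apply/negP => /eqP[e _]; move: ay; rewrite e ltxx.
  have count p q r : (p + q.+1 + 3 = 2 * r -> p.+1 + (1 + (1 + q)) + 3 = 2 * (1 + r))%N.
    by lia.
  by apply: count; rewrite -cntL.
Qed.

End Invariant.

Lemma ds_inv_reach (R : realType) (n : nat) (X : set 'rV[R]_n)
    (g : 'rV[R]_n -> 'rV[R]_2) (N : nat) (s : ds_state R n) :
  ds_reach X g N s -> ds_inv X g N s.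
Proof.
elim=> [s0 [e1 e2 xL xR h1 h2 h3 h4]|N' s1 s2 _ IH st]; first exact: ds_inv_start h1 h2 h3 h4.
exact: ds_inv_step IH st.
Qed.

(** * Termination from a finite classification of the solutions *)

Section Termination.
Variables (R : realType) (n : nat).
Variables (X : set 'rV[R]_n) (g : 'rV[R]_n -> 'rV[R]_2).
Implicit Types (s : ds_state R n) (lam : 'rV[R]_2) (x : 'rV[R]_n).
Variables (F : finType) (tau : 'rV[R]_n -> F).
(* Think of points with equal tau as lying in the relative interior of the same
   face of the set of all (x, t) with g x <= t. *)
Hypothesis tau_argmin : forall lam x x', 0 < lam 0 0 -> 0 < lam 0 1 ->
  argmin X (fun z => dotv lam (g z)) x -> X x' -> tau x = tau x' ->
  dotv lam (g x') <= dotv lam (g x).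

(* A successful iteration creates one pair but reaches a new value of tau, so
   the factor 2 makes the measure decrease. *)
Definition ds_measure s : nat :=
  2 * #|[predC [seq tau x | x <- enum_fset (dsX s)]]| + #|` dsL s|.

Lemma ds_measure_step N s s' :
  ds_inv X g N s -> ds_step X g s s' -> (ds_measure s' < ds_measure s)%N.
Proof.
move=> I [a b x abL xmin]; rewrite /ds_update /ds_measure.
have cntL : #|` dsL s| = #|` (dsL s `\ (a, b))%fset|.+1 by rewrite (cardfsD1 (a, b)) abL.
have [ab ba] := dsL_lt I abL; have [aY bY] := dsL_sub I abL.
case: ifPn => [lt|_]; last by rewrite /= cntL addnS.
(* An earlier solution of the same type would be a minimizer too, but its image is in [dsY s], hence
   on or above the line through [a] and [b], while [g x] is strictly below. *)
have new : tau x \notin [seq tau x | x <- enum_fset (dsX s)].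
  apply/negP => /mapP[x' x'X e]; have [Xx' gx'] := dsX_sub I x'X.
  have := tau_argmin _ _ xmin Xx' e; rewrite !mxE /= !subr_gt0 => /(_ ba ab).
  apply/negP; rewrite -ltNge; apply: (lt_le_trans lt).
  exact: above_hull_chord (dsY_img I bY) (dsY_img I aY) (dsY_img I gx')
    (dsY_nondom I aY) (dsY_nondom I bY) (dsY_hull I aY) (dsY_hull I bY) ab
    (dsL_consecutive I abL gx').
have /proper_card lt1 : [predC [seq tau z | z <- enum_fset (x |` dsX s)%fset]]
    \proper [predC [seq tau z | z <- enum_fset (dsX s)]].
  apply/properP; split.
    apply/fintype.subsetP => t; rewrite !inE; apply: contraNN => /mapP[z zX ->].
    by apply: map_f; rewrite !inE zX orbT.
  exists (tau x); first by rewrite inE new.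
  by rewrite !inE negbK; apply: map_f; rewrite !inE eqxx.
have le2 : (#|` ([fset (a, g x); (g x, b)] `|` dsL s `\ (a, b))%fset|
    <= 2 + #|` (dsL s `\ (a, b))%fset|)%N.
  rewrite cardfsU; apply: leq_trans (leq_subr _ _) _.
  by rewrite leq_add2r cardfs2; case: eqP.
have ltn_measure p q r t : (p < q -> r <= 2 + t -> 2 * p + r < 2 * q + t.+1)%N by lia.
by rewrite cntL; apply: ltn_measure.
Qed.

Lemma ds_no_infinite_run :
  ~ exists run : nat -> ds_state R n,
      ds_init X g (run 0%N) /\ forall i, ds_step X g (run i) (run i.+1).
Proof.
case=> run [run0 runS].
have I i : ds_inv X g i (run i).
  by apply: ds_inv_reach; elim: i => [|i IH]; [left|right with (run i)].
have dec i : (i + ds_measure (run i) <= ds_measure (run 0))%N.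
  elim: i => [//|i]; apply: leq_trans.
  by rewrite addSnnS leq_add2l (ds_measure_step (I i)).
have := dec (ds_measure (run 0)).+1.
by rewrite addSn ltnNge leq_addr.
Qed.

End Termination.

(** * Content of the returned sets and number of iterations *)

Lemma conv_hull2 (R : realType) (p : nat) (A : set 'rV[R]_p) (a b : 'rV[R]_p) (t : R) :
  A a -> A b -> 0 <= t <= 1 ->
  conv_hull A ((1 - t) *: a + t *: b).
Proof.
move=> Aa Ab /andP[t0 t1].
exists 2%N, (fun i : 'I_2 => if i == 0 then 1 - t else t),
  (fun i : 'I_2 => if i == 0 then a else b); split.
- by move=> i; case: ifP; rewrite ?subr_ge0.
- by rewrite !big_ord_recl big_ord0 /= addr0 subrK.
- by move=> i; case: ifP.
- by rewrite !big_ord_recl big_ord0 /= addr0.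
Qed.

Section Correctness.
Variables (R : realType) (n : nat).
Variables (X : set 'rV[R]_n) (g : 'rV[R]_n -> 'rV[R]_2).
Variables (N : nat) (s : ds_state R n).
Hypothesis I : ds_inv X g N s.

Lemma dsY_nondominated y : y \in dsY s -> nondominated X g y.
Proof.
move=> yY; have [x xX gx] := dsY_sub I yY; exists x => //.
split=> [|[x' [Xx' _ [le]]]]; first by case: (dsX_sub I xX).
by apply; rewrite gx in le *; apply: (dsY_nondom I yY) le; exists x'.
Qed.

(** Above a point of [dsY s] or of an explored chord, a point outside [dsY s] is above a convex
    combination of nondominated points other than itself. *)
Lemma ext_supp_sub_dsY : dsL s = fset0 ->
  ext_supp_nondominated X g `<=` [set` dsY s].
Proof.
move=> L0 y [Zy ext] /=; apply/negPn/negP => yNY.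
have nd c : c \in dsY s -> (nondominated X g `\ y) c.
  by move=> cY; split; [exact: dsY_nondominated|move=> e; rewrite -e cY in yNY].
have [[c cY cy]|[a [b [aY bY /andP[ay yb] ab]]]] := dsL_cover I Zy.
  apply: ext; exists c => //; have := conv_hull2 (nd _ cY) (nd _ cY) (t := 0).
  by rewrite lexx ler01 scale0r subr0 scale1r addr0 => /(_ isT).
rewrite L0 inE => -[//|/(_ _ Zy)]; rewrite !dotv2 !mxE /= => lb.
have p : 0 < b 0 0 - a 0 0 by rewrite subr_gt0.
(* The parameter at which the chord from [a] to [b] has the first coordinate of [y]. *)
pose t := (y 0 0 - a 0 0) / (b 0 0 - a 0 0).
have te : t * (b 0 0 - a 0 0) = y 0 0 - a 0 0 by rewrite mulfVK ?gt_eqF.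
apply: ext; exists ((1 - t) *: a + t *: b).
  apply: conv_hull2 (nd _ aY) (nd _ bY) _.
  by rewrite divr_ge0 ?subr_ge0 ?(ltW ab) //= ler_pdivrMr // mul1r lerD2r.
apply/vle2; rewrite !mxE; split; first by lra.
rewrite -(ler_pM2l p).
have : (b 0 0 - a 0 0) * ((1 - t) * a 0 1 + t * b 0 1) =
  (b 0 0 - a 0 0) * a 0 1 + (y 0 0 - a 0 0) * (b 0 1 - a 0 1) by rewrite -te; ring.
by move=> ->; lra.
Qed.

(** [dsX s] may also hold solutions whose image is supported but not extreme, so the set is cut down
    to those with an extreme image. *)
Lemma ds_representative : dsL s = fset0 ->
  exists2 S, representative X g S & S `<=` [set` dsX s].
Proof.
move=> L0; exists [set x | x \in dsX s /\ ext_supp_nondominated X g (g x)].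
  split=> [x [/(dsX_sub I)[]//]|]; apply/seteqP; split=> [_ [x [_ ?] <-] //|y ey].
  have /(dsY_sub I)[x xX gx] := ext_supp_sub_dsY L0 ey.
  by exists x => //; split=> //; rewrite gx.
by move=> x [].
Qed.

Lemma ds_iterations : dsL s = fset0 ->
  ((2 < #|` dsY s|)%N -> N = (2 * #|` dsY s| - 3)%N) /\
  (#|` dsY s| = 1%N -> N = 0%N).
Proof.
move=> L0; have := ds_count I; rewrite L0 cardfs0.
move: (#|` dsY s|) => v [cnt|[_ -> ->]]; last by [].
(* For a single point the count would read [N + 3 = 2], which is impossible. *)
by split; lia.
Qed.

End Correctness.

(** * Hulls of finite families, closedness, continuity and compactness *)

Lemma finite_set_range (T : eqType) (A : set T) : finite_set A ->
  exists (q : nat) (u : 'I_q -> T), A = range u.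
Proof.
move=> /finite_seqP[r ->]; exists (size r), (tnth (in_tuple r)).
apply/seteqP; split=> [x /= xr|_ [j _ <-] /=]; last exact: mem_tnth.
by have /tnthP[j ->] : x \in in_tuple r by []; exists j.
Qed.

Definition simplex (R : realType) (p : nat) : set 'rV[R]_p :=
  [set mu | (forall i, 0 <= mu 0 i) /\ \sum_i mu 0 i = 1].

(** Terms that use the same index are merged by adding their coefficients, so a combination of any
    length becomes one weight vector. *)
Lemma conv_hull_range (R : realType) (n p : nat) (v : 'I_p -> 'rV[R]_n) :
  conv_hull (range v) = (fun mu => mu *m \matrix_i v i) @` @simplex R p.
Proof.
have mulE (mu : 'rV[R]_p) : mu *m \matrix_i v i = \sum_i mu 0 i *: v i.
  by rewrite mulmx_sum_row; apply: eq_bigr => i _; rewrite rowK.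
apply/seteqP; split=> [_ [N [lam [ys [lam0 lam1 ysv ->]]]]|_ [mu [mu0 mu1] <-]];
    last first.
  by exists p, (fun i => mu 0 i), v; split=> // i; exists i.
have /choice[h hE] j : exists i, v i = ys j by have [i _ <-] := ysv j; exists i.
exists (\row_i \sum_(j | h j == i) lam j).
  split=> [i|]; first by rewrite mxE sumr_ge0.
  rewrite -lam1 (partition_big h predT) //=.
  by apply: eq_bigr => i _; rewrite mxE.
rewrite mulE (partition_big h predT) //=; apply: eq_bigr => i _.
by rewrite mxE scaler_suml; apply: eq_bigr => j /eqP <-; rewrite hE.
Qed.

Lemma continuous_coord (R : realType) (p : nat) (i : 'I_p) :
  continuous (fun mu : 'rV[R]_p => mu 0 i : R).
Proof. exact: coord_continuous. Qed.

Lemma continuous_sumr (R : realType) (T : topologicalType) (I : finType)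
    (F : I -> T -> R) : (forall i, continuous (F i)) ->
  continuous (fun x => \sum_i F i x).
Proof. by move=> Fc; apply: continuous_big => // -[a b]; exact: add_continuous. Qed.

Lemma continuous_linear_form (R : realType) (p : nat) (c : 'I_p -> R) :
  continuous (fun mu : 'rV[R]_p => \sum_i mu 0 i * c i).
Proof.
apply: continuous_sumr => i mu; apply: continuousM; first exact: continuous_coord.
exact: cst_continuous.
Qed.

Lemma continuous_bigmaxr (R : realType) (T : topologicalType) (I : Type)
    (r : seq I) (F0 : T -> R) (F : I -> T -> R) :
  continuous F0 -> (forall i, continuous (F i)) ->
  continuous (fun x => \big[Num.max/F0 x]_(i <- r) F i x).
Proof.
move=> F0c Fc; elim: r => [|i r IH].
  by under eq_fun do rewrite big_nil.
under eq_fun do rewrite big_cons.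
by move=> x; apply: (continuous_max (f := F i)); [exact: Fc|exact: IH].
Qed.

Lemma closed_forall (T : topologicalType) (I : Type) (A : I -> set T) :
  (forall i, closed (A i)) -> closed [set x | forall i, A i x].
Proof.
move=> Ac; have -> : [set x | forall i, A i x] = \bigcap_i A i.
  by apply/seteqP; split=> x /= H i //; exact: H.
by apply: closed_bigI => i _.
Qed.

Lemma closed_preimage (T U : topologicalType) (f : T -> U) (D : set U) :
  continuous f -> closed D -> closed (f @^-1` D).
Proof. by move=> fc; apply: preimage_closed => x _; exact: fc. Qed.

(** The open interval between the floor of a non-integer and the next integer is a neighbourhood
    free of integers. *)
Lemma closed_int (R : realType) : closed [set x : R | x \is a Num.int].
Proof.
rewrite -openC openE => x /= /negP xNint; rewrite /interior.
have xin : x \in `](Num.floor x)%:~R, (Num.floor x + 1)%:~R[%R.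
  rewrite in_itv /= floorD1_gt andbT lt_neqAle floor_le andbT.
  by apply: contraNneq xNint => <-; exact: intr_int.
have := near_in_itvoo xin; apply: filterS => y; rewrite in_itv /= => yin yint.
move: yin; have /intrP[z ->] := yint; rewrite !ltr_int; lia.
Qed.

Lemma compact_simplex (R : realType) (p : nat) : compact (@simplex R p).
Proof.
apply: bounded_closed_compact.
  exists 1; split=> // M M1 mu [mu0 mu1] /=.
  rewrite [leLHS]/Num.norm /= mx_normrE; apply: bigmax_le => [|[j i] _ /=].
    by rewrite (le_trans ler01) // ltW.
  rewrite ord1 ger0_norm //; apply: le_trans (ltW M1).
  by rewrite -mu1 (bigD1 i) //= lerDl sumr_ge0.
apply: closedI.
  apply: closed_forall => i.
  exact: (closed_preimage (@continuous_coord _ _ i) (@closed_ge _ 0)).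
apply: (closed_preimage _ (@closed_eq _ 1)).
by apply: continuous_sumr => i; exact: continuous_coord.
Qed.

Lemma dotv_delta (R : realType) (p : nat) (i : 'I_p) (y : 'rV[R]_p) :
  dotv (delta_mx 0 i) y = y 0 i.
Proof.
rewrite /dotv (bigD1 i) //= mxE !eqxx mul1r big1 ?addr0 // => j ji.
by rewrite mxE eqxx (negPf ji) mul0r.
Qed.

(** [S] exceeds every ratio [b j / a j], so its inverse is a small enough step; the summand 1 keeps
    [S] positive. Where [a j = 0] the step changes nothing. *)
Lemma small_step_back (R : realType) (J : finType) (a b : J -> R) :
  (forall j, 0 <= a j) -> (forall j, a j = 0 -> b j = 0) ->
  exists2 e, 0 < e & forall j, 0 <= a j + e * (a j - b j).
Proof.
move=> a0 ab; pose S := 1 + \sum_j `|b j / a j|.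
have S0 : 0 < S by rewrite ltr_pwDl // sumr_ge0.
exists S^-1 => [|j]; first by rewrite invr_gt0.
have [aj0|aj0] := eqVneq (a j) 0; first by rewrite aj0 (ab _ aj0) subrr mulr0 addr0.
have aj : 0 < a j by rewrite lt_neqAle eq_sym aj0 a0.
have bS : b j <= S * a j.
  rewrite -ler_pdivrMr //; apply: le_trans (ler_norm _) _.
  by rewrite /S (bigD1 j) //= addrCA lerDl addr_ge0 // sumr_ge0.
have : S^-1 * b j <= a j by rewrite ler_pdivrMl.
have : 0 <= S^-1 * a j by rewrite mulr_ge0 // invr_ge0 ltW.
by rewrite mulrBr; lra.
Qed.

(** * Finitely many scenarios: existence of minima and finiteness of types *)

Section Robust.
Variables (R : realType) (n k m p q : nat).
Variables (v : 'I_p -> 'rV[R]_n) (u : 'I_q -> 'rV[R]_m) (j0 : 'I_q).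
Variables (X : set 'rV[R]_n) (f : 'I_2 -> 'rV[R]_n -> 'rV[R]_m -> R).
Variable l : 'I_2 -> 'I_q -> {linear 'rV[R]_n -> R^o}.
Hypothesis X_def : X = conv_hull (range v) `&` @mixed_int R n k.
Hypothesis f_l : forall i j x, X x -> f i x (u j) = l i j x.

Let V : 'M[R]_(p, n) := \matrix_i v i.
Let g := robust f (range u).

(** The feasible set pulled back to convex weights, a compact set on which the minimization is
    carried out. *)
Definition weights : set 'rV[R]_p :=
  [set mu | simplex mu /\ mixed_int k (mu *m V)].

Lemma X_weights : X = (fun mu => mu *m V) @` weights.
Proof.
rewrite X_def conv_hull_range; apply/seteqP; split.
  by move=> _ [[mu Smu <-] imu]; exists mu.
by move=> _ [mu [Smu imu] <-]; split=> //; exists mu.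
Qed.

(** The supremum of a finite nonempty set is its maximum; the default value, taken at [j0], is
    itself one of the entries. *)
Lemma robust_bigmax x i :
  g x 0 i = \big[Num.max/f i x (u j0)]_(j < q) f i x (u j).
Proof.
rewrite mxE; apply/le_anti/andP; split.
  apply: ge_sup; first by exists (f i x (u j0)), (u j0); [exists j0|].
  by move=> _ [_ [j _ <-] <-]; exact: le_bigmax_seq.
apply: bigmax_le => [|j _]; apply: ub_le_sup;
  try (by exists (u j0); [exists j0|]); try (by exists (u j); [exists j|]);
  exists (\big[Num.max/f i x (u j0)]_(j < q) f i x (u j));
  by move=> _ [_ [j' _ <-] <-]; exact: le_bigmax_seq.
Qed.

Lemma robust_ge x i j : f i x (u j) <= g x 0 i.
Proof. by rewrite robust_bigmax; exact: le_bigmax_seq. Qed.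

Lemma robust_le x i c : (forall j, f i x (u j) <= c) -> g x 0 i <= c.
Proof. by move=> fc; rewrite robust_bigmax; apply: bigmax_le. Qed.

(** [f] agrees with the linear forms only on [X]; written in these forms, the robust objective
    extends continuously to all weight vectors. *)
Definition robust_weights i (mu : 'rV[R]_p) : R :=
  \big[Num.max/(\sum_a mu 0 a * l i j0 (v a))]_(j < q) \sum_a mu 0 a * l i j (v a).

Lemma robust_weightsE i mu : weights mu -> g (mu *m V) 0 i = robust_weights i mu.
Proof.
move=> Wmu; have fE j : f i (mu *m V) (u j) = \sum_a mu 0 a * l i j (v a).
  rewrite f_l; last by rewrite X_weights; exists mu.
  rewrite mulmx_sum_row linear_sum; apply: eq_bigr => a _.
  by rewrite linearZ rowK.
by rewrite robust_bigmax fE; apply: eq_bigr => j _; rewrite fE.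
Qed.

Lemma continuous_robust_weights i : continuous (robust_weights i).
Proof. by apply: continuous_bigmaxr => [|j]; exact: continuous_linear_form. Qed.

Lemma compact_weights : compact weights.
Proof.
apply: compact_closedI; first exact: compact_simplex.
have Vint i : closed [set mu : 'rV[R]_p | (mu *m V) 0 i \is a Num.int].
  rewrite (_ : mkset _ = (fun mu : 'rV[R]_p => \sum_a mu 0 a * V a i) @^-1`
      [set x | x \is a Num.int]).
    by apply: (closed_preimage _ (@closed_int R)); exact: continuous_linear_form.
  by apply/seteqP; split=> mu /=; rewrite mxE.
(* The proofs of [i < k] index the inner intersection. *)
apply: closed_forall => i; apply: (@closed_forall _ (i < k)%N) => _; exact: Vint.
Qed.

(** The extreme value theorem on weights. [D] is the whole line for weighted problems and a lower
    half-line for the second stage of a lexicographic minimum. *)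
Lemma robust_argmin_exists lam i (D : set R) : closed D ->
  (exists2 x, X x & D (g x 0 i)) ->
  exists x, argmin [set x | X x /\ D (g x 0 i)] (fun x => dotv lam (g x)) x.
Proof.
move=> Dc [x Xx Dx].
pose K := weights `&` [set mu | D (robust_weights i mu)].
have Kc : compact K.
  apply: compact_closedI compact_weights _.
  exact: (closed_preimage (@continuous_robust_weights i) Dc).
have K0 : K !=set0.
  have : X x by []. rewrite X_weights => -[mu Wmu e]; exists mu; split=> //=.
  by rewrite -robust_weightsE // e.
have hc : continuous (fun mu => \sum_j lam 0 j * robust_weights j mu).
  apply: continuous_sumr => j mu; apply: continuousM; first exact: cst_continuous.
  exact: continuous_robust_weights.
have [mu] := EVT_min_rV K0 Kc (continuous_subspaceT hc).
rewrite inE => -[Wmu Dmu] mumin; exists (mu *m V); split=> /=.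
  by rewrite robust_weightsE // X_weights; split=> //; exists mu.
move=> x' [+ Dx']; rewrite X_weights => -[mu' Wmu' e]; rewrite -e in Dx' *.
have hE nu : weights nu ->
    dotv lam (g (nu *m V)) = \sum_j lam 0 j * robust_weights j nu.
  by move=> Wnu; apply: eq_bigr => j _; rewrite robust_weightsE.
by rewrite !hE //; apply: mumin; rewrite inE; split=> //=; rewrite -robust_weightsE.
Qed.

Lemma robust_argmin_weight lam : X !=set0 ->
  exists x, argmin X (fun x => dotv lam (g x)) x.
Proof.
move=> [x Xx]; have [|y [[Xy _] ymin]] :=
    robust_argmin_exists lam (i := 0) (D := setT) closedT; first by exists x.
by exists y; split=> // z Xz; exact: ymin.
Qed.

Lemma robust_lexmin i j : X !=set0 ->
  exists e x, is_min X (fun x => g x 0 i) e /\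
    argmin [set x | X x /\ g x 0 i <= e] (fun x => g x 0 j) x.
Proof.
move=> /(robust_argmin_weight (delta_mx 0 i))[x [Xx xmin]].
have [|y [[Xy yx] ymin]] := robust_argmin_exists (delta_mx 0 j) (i := i)
    (@closed_le _ (g x 0 i)); first by exists x => /=.
exists (g x 0 i), y; split.
  by exists x => //; split=> // x' Xx'; have := xmin _ Xx'; rewrite !dotv_delta.
by split=> // x' Xx'; have := ymin _ Xx'; rewrite !dotv_delta.
Qed.

(** Weights lie between 0 and 1, so the sum of all absolute entries of [V] is a bound. It leaves
    finitely many values for the integer coordinates. *)
Lemma X_bounded : exists B : nat, forall x i, X x -> `|x 0 i| <= B%:R.
Proof.
exists (Num.bound (\sum_a \sum_i `|V a i|)) => x i.
rewrite X_weights => -[mu [[mu0 mu1] _] <-].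
apply: le_trans (ltW (archi_boundP _)); last first.
  by rewrite !sumr_ge0 // => a _; rewrite sumr_ge0.
rewrite mxE; apply: le_trans (ler_norm_sum _ _ _) _; apply: ler_sum => a _.
rewrite normrM ger0_norm // (bigD1 i) //= -[leLHS]addr0 lerD //.
  by rewrite ler_piMl // -mu1 (bigD1 a) //= lerDl sumr_ge0.
by rewrite sumr_ge0.
Qed.

Variable B : nat.
Hypothesis X_bound : forall x i, X x -> `|x 0 i| <= B%:R.

(** A point can have several weight vectors; one is fixed so that its support can enter the type. *)
Definition weights_of (x : 'rV[R]_n) : 'rV[R]_p :=
  xget 0 [set mu | weights mu /\ mu *m V = x].

Lemma weights_ofP x : X x -> weights (weights_of x) /\ weights_of x *m V = x.
Proof.
rewrite X_weights => -[mu Wmu e].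
exact: (@xgetI _ 0 [set mu | weights mu /\ mu *m V = x] mu (conj Wmu e)).
Qed.

(** The shift by [B] turns an integer coordinate into a natural number at most [2 * B], which
    truncation records exactly. *)
Definition combinatorial_type (x : 'rV[R]_n) :
    {ffun 'I_p -> bool} * {ffun 'I_2 * 'I_q -> bool} * {ffun 'I_n -> 'I_(2 * B).+1} :=
  ([ffun a => weights_of x 0 a == 0],
   [ffun ij => f ij.1 x (u ij.2) == g x 0 ij.1],
   [ffun i => inord (Num.truncn (x 0 i + B%:R))]).

Lemma combinatorial_type_argmin (lam : 'rV[R]_2) x x' :
  0 < lam 0 0 -> 0 < lam 0 1 ->
  argmin X (fun z => dotv lam (g z)) x -> X x' ->
  combinatorial_type x = combinatorial_type x' ->
  dotv lam (g x') <= dotv lam (g x).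
Proof.
move=> lam0 lam1 [Xx xmin] Xx' [/ffunP eW /ffunP eA /ffunP eI].
have [[[mu0 mu1] imu] xE] := weights_ofP Xx.
have [[[mu'0 mu'1] imu'] x'E] := weights_ofP Xx'.
set mu := weights_of x in mu0 mu1 imu xE.
set mu' := weights_of x' in mu'0 mu'1 imu' x'E.
rewrite xE in imu; rewrite x'E in imu'.
have eint (i : 'I_n) : (i < k)%N -> x 0 i = x' 0 i.
  move=> ik; have trunc_lt z : X z -> (Num.truncn (z 0 i + B%:R)%R < (2 * B).+1)%N.
    move=> Xz; have := X_bound i Xz; rewrite ler_norml => /andP[z0 z1].
    by rewrite truncn_lt_nat -?natr1 ?natrM; lra.
  have z_int z : X z -> mixed_int k z -> z 0 i + B%:R \is a Num.nat.
    move=> Xz zi; have := X_bound i Xz; rewrite ler_norml => /andP[z0 _].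
    rewrite natrEint rpredD ?zi ?intr_nat //=; lra.
  have := eI i; rewrite !ffunE => /(congr1 val); rewrite /= !inordK ?trunc_lt //.
  move=> /(congr1 (fun r => r%:R : R)); rewrite !truncnK; first exact: addIr.
    by apply: z_int.
  by apply: z_int.
(* Both x' and the step back x + e (x - x') satisfy the constraints mu >= 0 and
   f i x (u j) <= t i with the slacks a and a + e (a - b). *)
pose a (J : 'I_p + 'I_2 * 'I_q) := match J with
  | inl a => mu 0 a | inr (i, j) => g x 0 i - f i x (u j) end.
pose b (J : 'I_p + 'I_2 * 'I_q) := match J with
  | inl a => mu' 0 a | inr (i, j) => g x' 0 i - f i x' (u j) end.
have [|J|e e0 eP] := @small_step_back _ _ a b.
- by case=> [a'|[i j]] //=; rewrite subr_ge0 robust_ge.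
(* A slack that vanishes at [x] vanishes at [x']: the supports of the weights agree, and so do the
   active scenarios. *)
- case: J => [a'|[i j]] /=.
    by move=> /eqP; have := eW a'; rewrite !ffunE => -> /eqP.
  move=> /eqP; rewrite subr_eq0 eq_sym.
  by have := eA (i, j); rewrite !ffunE /= => -> /eqP ->; rewrite subrr.
pose nu := mu + e *: (mu - mu').
have nuE : nu *m V = x + e *: (x - x').
  by rewrite mulmxDl -scalemxAl mulmxBl xE x'E.
have Xnu : X (x + e *: (x - x')).
  rewrite X_weights; exists nu; rewrite ?nuE //; split; last first.
    rewrite nuE => i ik; rewrite !mxE (eint _ ik) subrr mulr0 addr0.
    exact: imu'.
  split=> [i|]; first by have := eP (inl i); rewrite !mxE.
  under eq_bigr do rewrite !mxE mulrBr.
  by rewrite big_split /= sumrB -!mulr_sumr mu1 mu'1 subrr addr0.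
(* By linearity in each scenario, this is nonnegativity of the slack after the step. *)
have gnu i : g (x + e *: (x - x')) 0 i <= g x 0 i + e * (g x 0 i - g x' 0 i).
  apply: robust_le => j; have := eP (inr (i, j)); rewrite /= !f_l //.
  have -> : l i j (x + e *: (x - x')) = l i j x + e * (l i j x - l i j x').
    by rewrite (linearD (l i j)) linearZ_LR (linearB (l i j)).
  lra.
have := xmin _ Xnu; rewrite !dotv2.
have := ler_wpM2l (ltW lam0) (gnu 0); have := ler_wpM2l (ltW lam1) (gnu 1).
(* Minimality of [x] against the step gives [0 <= e * (dotv lam (g x) - dotv lam (g x'))], and [e]
   cancels. *)
move=> h0 h1 h; rewrite -subr_ge0 -(pmulr_rge0 _ e0); lra.
Qed.

End Robust.

Unset Implicit Arguments.

Theorem lemma6 (R : realType) (n k m : nat)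
    (P X : set 'rV[R]_n) (U : set 'rV[R]_m)
    (f : 'I_2 -> 'rV[R]_n -> 'rV[R]_m -> R)
    (k_le_n : (k <= n)%N)
    (P_polytope : polytope P)
    (X_def : X = P `&` @mixed_int R n k)
    (X_nonempty : X !=set0)
    (f_linear : forall i xi, U xi -> linear_on X (fun x => f i x xi))
    (f_quasiconvex : forall i x, X x -> quasiconvex_on (conv_hull U) (f i x))
    (f_continuous : forall i x, X x -> {within conv_hull U, continuous (f i x)})
    (U_nonempty : U !=set0)
    (U_finite : finite_set U) :
  ds_terminates X (robust f U) /\
  forall (N : nat) (s : ds_state R n), ds_returns_after X (robust f U) N s ->
    [/\ ext_supp_nondominated X (robust f U) `<=` [set` dsY s],
        exists2 S : set 'rV[R]_n,
          representative X (robust f U) S & S `<=` [set` dsX s],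
        (2 < #|` dsY s|)%N -> N = (2 * #|` dsY s| - 3)%N
      & #|` dsY s| = 1%N -> N = 0%N].
Proof.
have [p [v PE]] : exists p (v : 'I_p -> 'rV[R]_n), P = conv_hull (range v).
  case: P_polytope => W /finite_set_range[p [v WE]] PE.
  by exists p, v; rewrite -WE.
have [q [u UE]] := finite_set_range U_finite; subst U.
have [_ [j0 _ _]] := U_nonempty.
have /choice[l0 l0P] (ij : 'I_2 * 'I_q) : exists l : {linear 'rV[R]_n -> R^o},
    forall x, X x -> f ij.1 x (u ij.2) = l x.
  by apply: f_linear; exists ij.2.
pose l i j := l0 (i, j).
have f_l i j x : X x -> f i x (u j) = l i j x by exact: (l0P (i, j)).
rewrite PE in X_def.
have [B X_bound] := X_bounded X_def.
set g := robust f (range u).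
split.
  split.
  (* The two ends are lexicographic minima, with the objectives in opposite order. *)
  - have [e1 [xL [e1P xLP]]] := robust_lexmin j0 X_def f_l 0 1 X_nonempty.
    have [e2 [xR [e2P xRP]]] := robust_lexmin j0 X_def f_l 1 0 X_nonempty.
    by exists (ds_start g xL xR); exact: (DsInit e1P xLP e2P xRP).
  - move=> N s _ /fset0Pn[[yl yr] inL].
    have [x xmin] := robust_argmin_weight j0 X_def f_l (ds_weight yl yr) X_nonempty.
    by exists (ds_update g s yl yr x); exact: DsStep inL xmin.
  - apply: (ds_no_infinite_run (tau := combinatorial_type k v u f B)) => lam x x' lam0 lam1 xmin Xx' e.
    exact: (combinatorial_type_argmin j0 X_def f_l X_bound lam0 lam1 xmin Xx' e).
move=> N s [/ds_inv_reach I L0].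
have [N2 N1] := ds_iterations I L0.
by split=> //; [exact: ext_supp_sub_dsY I L0|exact: ds_representative I L0].
Qed.
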